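(* Let $\tau\in\mathbb{Q}$ with $\tau\neq 0,1$, and let $\mathbb{Q}_\tau$ be the weighted average quandle on $\mathbb{Q}$ with weight $\tau$. (1) A relation $\sim$ on $\mathbb{Q}$ is a $\vartriangleright$-congruence on $\mathbb{Q}_\tau$ if and only if there exists a subgroup $D$ of $(\mathbb{Q},+)$ that is closed under multiplication by $\tau$ such that for all $x,y\in\mathbb{Q}$, $x\sim y \Leftrightarrow y-x\in D$. (2) A relation $\sim$ on $\mathbb{Q}$ is a $\vartriangleleft$-congruence on $\mathbb{Q}_\tau$ if and only if there exists a subgroup $D$ of $(\mathbb{Q},+)$ that is closed under multiplication by $\tau^{-1}$ such that for all $x,y\in\mathbb{Q}$, $x\sim y\Leftrightarrow y-x\in D$.
   Context: For $\tau\in\mathbb{Q}$, $\tau\ne0$, the weighted average quandle $\mathbb{Q}_\tau$ has underlying set $\mathbb{Q}$ and operation $x\vartriangleright y=\tau x+(1-\tau)y$; its inverse operation is $x\vartriangleleft y=\tau^{-1}x+(1-\tau^{-1})y$. It is called nontrivial when $\tau\neq 1$. For a binary operation $*$ on a set $M$, a $*$-congruence on $M$ is an equivalence relation $\sim$ on $M$ such that $a\sim c$ and $b\sim d$ imply $a*b\sim c*d$, for all $a,b,c,d\in M$. *)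

(* Defs.v *)
From Corelib Require Import RelationClasses.
From mathcomp Require Import all_boot all_order all_algebra.

Set Implicit Arguments.
Unset Strict Implicit.
Unset Printing Implicit Defensive.

Import GRing.Theory.

Local Open Scope ring_scope.

Definition wavg (tau x y : rat) : rat := tau * x + (1 - tau) * y.

Definition wavg_inv (tau x y : rat) : rat := tau^-1 * x + (1 - tau^-1) * y.

Definition is_congruence (M : Type) (op : M -> M -> M) (R : M -> M -> Prop)
    : Prop :=
  Equivalence R
  /\ forall a b c d : M, R a c -> R b d -> R (op a b) (op c d).

(* Subsets are Prop-valued, so that D need not be decidable; this is why the
   boolean predicates zmod_closed and zmodClosed are not used. *)
Definition is_subgroup (V : zmodType) (D : V -> Prop) : Prop :=
  [/\ D 0, forall x y : V, D x -> D y -> D (x + y)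
    & forall x : V, D x -> D (- x)].

Definition closed_under_mul (c : rat) (D : rat -> Prop) : Prop :=
  forall x : rat, D x -> D (c * x).

(* Main.v *)
Require Import Defs.
From Corelib Require Import RelationClasses.
From mathcomp Require Import all_boot all_order all_algebra.
From mathcomp Require Import ring.

Import GRing.Theory.

Local Open Scope ring_scope.

(** If [R] is a congruence for [wavg t], fixing one argument of the operation
    shows that a pair [R x y] with difference [d = y - x] yields pairs of
    differences [t * d] (second argument fixed) and [(1 - t) * d] (first
    argument fixed).  Since [1 - t] and [t] are invertible, the fixed argument
    can be chosen so that these pairs start at any prescribed point.  Chaining
    the two and using [t * d + (1 - t) * d = d], the pair [R x y] can be moved
    to any base point: [R] is translation invariant.  Hence [R] is the coset
    relation of the subgroup of its differences, which is stable under [t] by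
    the first of the two observations.  Conversely, the operation acts on
    differences by [(d, e) |-> t * d + e - t * e], which preserves any subgroup
    stable under [t].  The inverse operation is the weighted average of weight
    [tau^-1], so a single characterization serves for both parts. *)

Lemma wavg_congruence_shift_scaled (t : rat) (R : rat -> rat -> Prop) :
  t != 1 -> is_congruence (wavg t) R ->
  forall x y s, R x y -> R s (s + t * (y - x)).
Proof.
move=> t1 [eqR opR] x y s Rxy.
have t1' : 1 - t != 0 by rewrite subr_eq0 eq_sym.
(* The fixed argument solves [wavg t x b = s]. *)
pose b := (s - t * x) / (1 - t).
have /(opR x b y b Rxy) : R b b by reflexivity.
rewrite /wavg.
have -> : (1 - t) * b = s - t * x by rewrite mulrC divfK.
have -> : t * x + (s - t * x) = s by ring.
by have -> : t * y + (s - t * x) = s + t * (y - x) by ring.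
Qed.

(** The quandle operation of weight [t] with its arguments exchanged is the one
    of weight [1 - t]; this symmetry gives the other family of translates. *)
Lemma wavg_congruence_opp (t : rat) (R : rat -> rat -> Prop) :
  is_congruence (wavg t) R -> is_congruence (wavg (1 - t)) R.
Proof.
move=> [eqR opR]; split=> // a b c d Rac Rbd.
have wavgC u v : wavg (1 - t) u v = wavg t v u by rewrite /wavg; ring.
by rewrite !wavgC; apply: opR.
Qed.

Lemma wavg_congruence_shift (t : rat) (R : rat -> rat -> Prop) :
  t != 0 -> t != 1 -> is_congruence (wavg t) R ->
  forall x y s, R x y -> R s (s + (y - x)).
Proof.
move=> t0 t1 congR x y s Rxy.
have [eqR _] := congR.
have t1' : 1 - t != 1 by rewrite -subr_eq0 addrAC subrr add0r oppr_eq0.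
transitivity (s + t * (y - x)).
  exact: wavg_congruence_shift_scaled.
have -> : s + (y - x) = s + t * (y - x) + (1 - t) * (y - x) by ring.
by apply: wavg_congruence_shift_scaled => //; apply: wavg_congruence_opp.
Qed.

Lemma wavg_congruenceP (t : rat) (R : rat -> rat -> Prop) :
  t != 0 -> t != 1 ->
  is_congruence (wavg t) R <->
  exists D : rat -> Prop,
    [/\ is_subgroup D, closed_under_mul t D
      & forall x y : rat, R x y <-> D (y - x)].
Proof.
move=> t0 t1; split=> [congR | [D [[D0 DD DN] Dt RD]]].
  have [eqR _] := congR.
  have shift := @wavg_congruence_shift t R t0 t1 congR.
  exists (R 0); split; first split.
  - reflexivity.
  - move=> x y R0x R0y; transitivity x => //.
    by have := shift 0 y x R0y; rewrite subr0.
  - move=> x R0x; symmetry in R0x.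
    by have := shift x 0 0 R0x; rewrite !add0r.
  - move=> x R0x.
    have := @wavg_congruence_shift_scaled t R t1 congR 0 x 0 R0x.
    by rewrite add0r subr0.
  - move=> x y; split=> [/(shift x y 0) | /(shift 0 (y - x) x)].
      by rewrite add0r.
    by rewrite subr0 addrC subrK.
split=> [|a b c d /RD Dac /RD Dbd].
  split=> [x | x y /RD Dxy | x y z /RD Dxy /RD Dyz]; apply/RD.
  - by rewrite subrr.
  - by rewrite -opprB; apply: DN.
  - by rewrite -(subrKA y); apply: DD.
apply/RD.
have -> : wavg t c d - wavg t a b = t * (c - a) + ((d - b) - t * (d - b)).
  by rewrite /wavg; ring.
by apply: (DD); [apply: Dt | apply: DD => //; apply/DN/Dt].
Qed.

Theorem theorem6p1 (tau : rat) (tau_neq0 : tau != 0) (tau_neq1 : tau != 1) :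
  (forall R : rat -> rat -> Prop,
     is_congruence (wavg tau) R <->
     exists D : rat -> Prop,
       [/\ is_subgroup D, closed_under_mul tau D
         & forall x y : rat, R x y <-> D (y - x)])
  /\
  (forall R : rat -> rat -> Prop,
     is_congruence (wavg_inv tau) R <->
     exists D : rat -> Prop,
       [/\ is_subgroup D, closed_under_mul tau^-1 D
         & forall x y : rat, R x y <-> D (y - x)]).
Proof.
split=> R; first exact: wavg_congruenceP.
by apply: (@wavg_congruenceP tau^-1); rewrite ?invr_eq0 ?invr_eq1.
Qed.
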